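(* For integers $k\ge 1$ and $l\ge 2$, as $n\to\infty$, $$ex(n,P_l,C_{2k+1})=(1+o(1))\left(\frac n2\right)^l.$$
   Context: $C_k$ denotes the cycle with $k$ vertices and $P_l$ the path with $l$ vertices. $ex(n,H,F)$ is the maximum number of subgraphs isomorphic to $H$ in an $n$-vertex graph containing no subgraph isomorphic to $F$. *)

(* Defs.v *)
From HB Require Import structures.
From mathcomp Require Import all_boot all_order all_algebra.
From mathcomp Require Import all_classical all_reals all_analysis.
Set Implicit Arguments. Unset Strict Implicit. Unset Printing Implicit Defensive.

Definition is_graph (n : nat) (G : {set {set 'I_n}}) : bool :=
  [forall e in G, #|e| == 2].

Definition path_edges (n l : nat) (v : {ffun 'I_l -> 'I_n}) : {set {set 'I_n}} :=
  [set [set v i; v j] | i in 'I_l, j in 'I_l & (j : nat) == i.+1].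

Definition cycle_edges (n m : nat) (v : {ffun 'I_m -> 'I_n}) : {set {set 'I_n}} :=
  [set [set v i; v j] | i in 'I_m, j in 'I_m & (j : nat) == i.+1 %% m].

(* The subgraphs of G isomorphic to P_l (l vertices), identified with their
   edge sets (for l >= 2 a copy of P_l has no isolated vertex, so its edge
   set determines it). *)
Definition path_copies (n l : nat) (G : {set {set 'I_n}}) : {set {set {set 'I_n}}} :=
  [set E : {set {set 'I_n}} |
     [exists v : {ffun 'I_l -> 'I_n},
        [&& injectiveb v, E == path_edges v & E \subset G]]].

Definition has_cycle (n m : nat) (G : {set {set 'I_n}}) : bool :=
  [exists v : {ffun 'I_m -> 'I_n}, injectiveb v && (cycle_edges v \subset G)].

Definition ex_path_cycle (n l m : nat) : nat :=
  \max_(G : {set {set 'I_n}} | is_graph G && ~~ has_cycle m G) #|path_copies l G|.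

(* Main.v *)
(** In a [C_(2k+1)]-free graph on [n] vertices the neighbourhood [N(x)] contains
no path on [2k] vertices, hence spans O(n) edges.  Writing [D] for the sum of
the degrees, summing [d(u) + d(v) <= n + codeg(u, v)] over the edges and using
Cauchy-Schwarz then yields [D <= n^2/2 + O(n)].  The number of two-step walks
from [x] is the sum of the degrees over [N(x)], at most [D/2] plus the number of
edges inside [N(x)], hence at most [n^2/4 + O(n)].  So lengthening walks by two
vertices multiplies their number by at most [(n + O(1))^2/4], and there are at
most [2((n + O(1))/2)^l] walks on [l] vertices; every copy of [P_l] accounts for
two of them.  The complete bipartite graph between even and odd vertices gives
the matching lower bound. *)
Require Import Defs.
From HB Require Import structures.
From mathcomp Require Import all_boot all_order all_algebra.
From mathcomp Require Import zify.
Set Implicit Arguments. Unset Strict Implicit. Unset Printing Implicit Defensive.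

(** * Degrees, codegrees and walks in a loopless symmetric relation *)

Section Walks.
Variables (T : finType) (a : rel T).
Hypotheses (a_sym : symmetric a) (a_irr : irreflexive a).

Definition deg (x : T) : nat := \sum_y a x y.
(** Ordered pairs are counted, so each edge inside [S] contributes 2. *)
Definition inner (S : {set T}) : nat := \sum_(y in S) \sum_(z in S) a y z.
Definition nbh (x : T) : {set T} := [set y | a x y].

(** The index [j] counts steps; such a walk has [j + 1] vertices. *)
Fixpoint walks (j : nat) (x : T) : nat :=
  if j is j'.+1 then \sum_y a x y * walks j' y else 1.

Lemma sum_nbh x (F : T -> nat) : \sum_(y in nbh x) F y = \sum_y a x y * F y.
Proof.
rewrite big_mkcond /=; apply: eq_bigr => y _.
by rewrite inE; case: (a x y); rewrite ?mul1n.
Qed.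

(** The path grows at its head [y]: if all neighbours of [y] in [S] lay on the path, they would lie
    in [s], since [y] is not its own neighbour, so there would be at most [j < m] of them. *)
Lemma greedy_path (S : {set T}) m :
    S != set0 -> (forall y, y \in S -> m <= \sum_(z in S) a y z) ->
  forall j, j <= m ->
  exists y s, [/\ size s = j, uniq (y :: s), path a y s & {subset y :: s <= S}].
Proof.
move=> /set0Pn[y0 y0S] degS; elim=> [_|j IHj lt_jm].
  by exists y0, [::]; split=> // z; rewrite inE => /eqP->.
have [y [s [sz_s uniq_s path_s sS]]] := IHj (ltnW lt_jm).
have yS : y \in S by rewrite sS ?mem_head.
have [z /andP[zS /andP[ayz zs]]|no] := pickP
    [pred z | (z \in S) && (a y z && (z \notin s))].
  exists z, (y :: s); split => //.
  - by rewrite /= sz_s.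
  - rewrite cons_uniq uniq_s andbT inE negb_or zs andbT.
    by apply: contraTneq ayz => ->; rewrite a_irr.
  - by rewrite /= a_sym ayz.
  - by move=> w; rewrite inE => /orP[/eqP->|/sS].
have := degS y yS; rewrite leqNgt => /negP[]; apply: leq_ltn_trans lt_jm.
rewrite -sz_s; apply: leq_trans (card_size s); rewrite -sum1_card big_mkcond /=.
rewrite [X in _ <= X]big_mkcond /=; apply: leq_sum => z _.
by have /= := no z; case: (z \in S); case: (a y z); case: (z \in s).
Qed.

(** Degeneracy: a long path would grow greedily unless some vertex has fewer than [m] neighbours in
    [S]. Deleting it loses fewer than [2 * m] ordered pairs, and induction on the size of [S]
    applies. *)
Lemma inner_le_of_no_path (S : {set T}) m :
    (forall y s, size s = m -> uniq (y :: s) -> path a y s ->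
       ~ {subset y :: s <= S}) ->
  inner S <= 2 * m * #|S|.
Proof.
have [N] := ubnP #|S|; elim: N S => // N IHN S ltSN noS.
have [->|S0] := eqVneq S set0; first by rewrite /inner big_set0.
have [y /andP[yS ydeg]|no] :=
    pickP [pred y | (y \in S) && (\sum_(z in S) a y z < m)]; last first.
  have [y yS|y [s [? ? ? ?]]] := greedy_path S0 (m := m) _ (leqnn m).
    by rewrite leqNgt; have /= := no y; rewrite yS /= => ->.
  by have [] := noS y s.
have cS : #|S| = (#|S :\ y|).+1 by rewrite (cardsD1 y) yS.
have IH : inner (S :\ y) <= 2 * m * #|S :\ y|.
  apply: IHN => [|z s sz us ps sS]; first by rewrite -ltnS -cS.
  by apply: (noS z s) => // w /sS; rewrite !inE => /andP[].
have split1 F : \sum_(z in S) F z = F y + \sum_(z in S :\ y) F z :> nat.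
  rewrite (bigD1 y) //=; congr (_ + _); apply: eq_bigl => z.
  by rewrite !inE andbC.
have e2 : inner S = \sum_(z in S) a y z + \sum_(z in S :\ y) a y z + inner (S :\ y).
  rewrite {1}/inner split1 -addnA; congr (_ + _).
  rewrite -big_split /=; apply: eq_bigr => z _.
  by rewrite split1 a_sym.
have := split1 (a y : T -> nat); rewrite a_irr /= => e3.
rewrite e2 cS; rewrite /= in ydeg *; nia.
Qed.

(* The two copies of [\sum_(y in nbh z) deg y] count ordered adjacent pairs,
   by their first resp. second vertex in [nbh z]; only pairs inside [nbh z] are
   counted twice. *)
Lemma sum_deg_nbh_le z : 2 * (\sum_(y in nbh z) deg y) <= \sum_y deg y + inner (nbh z).
Proof.
set S := nbh z.
have e1 : \sum_(y in S) deg y = \sum_y \sum_w (y \in S) * a y w.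
  rewrite big_mkcond; apply: eq_bigr => y _; rewrite -big_distrr /=.
  by case: (y \in S); rewrite ?mul1n ?mul0n.
have e2 : \sum_(y in S) deg y = \sum_y \sum_w (w \in S) * a y w.
  rewrite e1 exchange_big /=; apply: eq_bigr => y _; apply: eq_bigr => w _.
  by rewrite a_sym.
have e3 : inner S = \sum_y \sum_w ((y \in S) && (w \in S)) * a y w.
  rewrite /inner big_mkcond; apply: eq_bigr => y _; rewrite big_mkcond /=.
  case: (y \in S) => /=; last by rewrite big1.
  by apply: eq_bigr => w _; case: (w \in S); rewrite ?mul1n ?mul0n.
rewrite mul2n -addnn {1}e1 e2 e3 -!big_split /=; apply: leq_sum => y _.
rewrite /deg -!big_split /=; apply: leq_sum => w _.
by case: (y \in S); case: (w \in S); case: (a y w).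
Qed.

(** Inclusion-exclusion for two neighbourhoods; the sum on the right is the codegree. *)
Lemma deg_add_le u v : deg u + deg v <= #|T| + \sum_x a x u * a x v.
Proof.
rewrite /deg -sum1_card -!big_split /=; apply: leq_sum => x _.
by rewrite (a_sym x u) (a_sym x v); case: (a u x); case: (a v x).
Qed.

(** Both sides count ordered triangles, by an edge and by the opposite vertex respectively. *)
Lemma sum_codeg :
  \sum_u \sum_v a u v * (\sum_x a x u * a x v) = \sum_x inner (nbh x).
Proof.
transitivity (\sum_u \sum_v \sum_x a x u * (a x v * a u v)).
  apply: eq_bigr => u _; apply: eq_bigr => v _; rewrite big_distrr /=.
  by apply: eq_bigr => x _; lia.
rewrite exchange_big /=.
under eq_bigr do rewrite exchange_big /=.
rewrite exchange_big /=; apply: eq_bigr => x _.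
rewrite exchange_big /= /inner sum_nbh; apply: eq_bigr => u _.
by rewrite -big_distrr /= sum_nbh.
Qed.

(** * Degree sum and walk counts when neighbourhoods span few edges *)

Section Sparse.
Variable c : nat.
Hypothesis inner_le : forall x, inner (nbh x) <= c * #|T|.

Lemma sum_deg_le : 2 * (\sum_x deg x) <= #|T| ^ 2 + 2 * c * #|T|.
Proof.
set D := \sum_x deg x; set n := #|T|; set Q := \sum_x deg x ^ 2.
have CS : 2 * D ^ 2 <= 2 * (n * Q).
  have -> : 2 * D ^ 2 = \sum_x \sum_y 2 * (deg x * deg y).
    rewrite -mulnn /D big_distrl big_distrr /=.
    by apply: eq_bigr => x _; rewrite -!big_distrr.
  have -> : 2 * (n * Q) = \sum_x \sum_y (deg x ^ 2 + deg y ^ 2).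
    under eq_bigr do rewrite big_split /= sum_nat_const.
    rewrite big_split /= sum_nat_const -/n -/Q.
    by rewrite -big_distrr /= -/Q mul2n -addnn.
  by apply: leq_sum => x _; apply: leq_sum => y _; exact: nat_Cauchy.
(* Each vertex [x] occurs [deg x] times as first and [deg x] times as second end of an ordered
   edge. *)
have sq : 2 * Q = \sum_u \sum_v a u v * (deg u + deg v).
  under [RHS]eq_bigr do under eq_bigr do rewrite mulnDr.
  under [RHS]eq_bigr do rewrite big_split /=.
  rewrite big_split /= [X in _ = _ + X]exchange_big /=.
  rewrite mul2n -addnn /Q; congr (_ + _); apply: eq_bigr => x _.
    by rewrite -big_distrl.
  by under [RHS]eq_bigr do rewrite a_sym; rewrite -big_distrl.
have bd : 2 * Q <= n * D + c * n ^ 2.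
  rewrite sq; apply: (@leq_trans (\sum_u \sum_v a u v * (n + \sum_x a x u * a x v))).
    apply: leq_sum => u _; apply: leq_sum => v _.
    by rewrite leq_mul2l deg_add_le orbT.
  under eq_bigr do under eq_bigr do rewrite mulnDr.
  under eq_bigr do rewrite big_split /= -big_distrl /=.
  rewrite big_split /= -big_distrl /= sum_codeg mulnC leq_add2l.
  apply: (@leq_trans (\sum_(x : T) c * n)); first by apply: leq_sum => x _.
  by rewrite sum_nat_const -/n; nia.
rewrite leqNgt; apply/negP => lt.
clearbody D Q n.
(* If [2D > n^2 + 2cn], then [h1] and [h2] force [2cnD < cn^3], while [2D >= n^2] gives the opposite
   inequality [h3]. *)
have h1 : 2 * D ^ 2 <= n ^ 2 * D + c * n ^ 3 by nia.
have h2 : D * (n ^ 2 + 2 * c * n) < D * (2 * D) by rewrite ltn_pmul2l //; lia.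
have h3 : c * n * n ^ 2 <= c * n * (2 * D) by rewrite leq_mul2l; apply/orP; right; lia.
rewrite !expnS !expn0 ?muln1 in h1 h2 h3; nia.
Qed.

(** The degree sum and the pairs inside the neighbourhood each contribute an error [2cn]; adding
    [4c^2] to [n^2 + 4cn] completes the square. *)
Lemma walks2_le z : 4 * walks 2 z <= (#|T| + 2 * c) ^ 2.
Proof.
have e : walks 2 z = \sum_(y in nbh z) deg y.
  rewrite /= sum_nbh; apply: eq_bigr => y _; congr (_ * _).
  by apply: eq_bigr => w _; rewrite muln1.
have := sum_deg_nbh_le z; have := sum_deg_le; have := inner_le z.
rewrite -e; move: (walks 2 z) (\sum_y _) (inner _) #|T| => w D q n ? ? ?.
have -> : (n + 2 * c) ^ 2 = n ^ 2 + 4 * (c * n) + 4 * c ^ 2 by lia.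
lia.
Qed.

(** A walk is cut at its third vertex [z]; its first two steps, reversed, form a walk from [z]. *)
Lemma sum_walksSS j :
  \sum_x walks j.+2 x = \sum_z walks j z * walks 2 z.
Proof.
transitivity (\sum_x \sum_y \sum_z walks j z * (a z y * (a y x * 1))).
  apply: eq_bigr => x _ /=; apply: eq_bigr => y _; rewrite big_distrr /=.
  by apply: eq_bigr => z _; rewrite (a_sym x) (a_sym y z); lia.
under eq_bigr do rewrite exchange_big /=.
rewrite exchange_big /=; apply: eq_bigr => z _.
rewrite exchange_big /= big_distrr /=; apply: eq_bigr => y _.
by rewrite !big_distrr /=; apply: eq_bigr.
Qed.

Lemma sum_walks_le j : 2 ^ j * \sum_x walks j x <= (#|T| + 2 * c) ^ j.+1.
Proof.
(* A single degree may far exceed [n/2], so only two-step extensions are bounded uniformly; the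
   induction therefore carries two consecutive lengths. *)
suff [] : 2 ^ j * (\sum_x walks j x) <= (#|T| + 2 * c) ^ j.+1 /\
    2 ^ j.+1 * (\sum_x walks j.+1 x) <= (#|T| + 2 * c) ^ j.+2 by [].
elim: j => [|j [IH1 IH2]]; split => //.
- by rewrite mul1n expn1 sum1_card leq_addr.
- have -> : \sum_x walks 1 x = \sum_x deg x.
    by apply: eq_bigr => x _ /=; apply: eq_bigr => y _; rewrite muln1.
  by have := sum_deg_le; move: (\sum_x deg x) #|T| => D n; lia.
rewrite sum_walksSS.
apply: (@leq_trans (2 ^ j * (\sum_x walks j x) * (#|T| + 2 * c) ^ 2)); last first.
  by rewrite -(addn2 j.+1) expnD leq_mul2r IH1 orbT.
rewrite -(addn2 j) expnD -(mulnA (2 ^ j)) -[leqRHS]mulnA leq_mul //.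
have := walks2_le; move: (walks 2) => w w_le.
rewrite -[2 ^ 2]/4 big_distrr big_distrl /=; apply: leq_sum => z _.
by rewrite mulnCA leq_mul2l w_le orbT.
Qed.

End Sparse.

Lemma card_walk_tuples j (x : T) :
  #|[set t : j.-tuple T | path a x t]| = walks j x.
Proof.
rewrite -sum1_card big_mkcond /=; under eq_bigr do rewrite inE.
elim: j x => [|j IHj] x.
  by rewrite (big_pred1 [tuple]) // => t; apply/esym/eqP/tuple0.
rewrite (reindex (fun p : T * j.-tuple T => [tuple of p.1 :: p.2])) /=; last first.
  exists (fun t => (thead t, [tuple of behead t])) => [[y t] _|t _] /=.
    by congr (_, _); apply: val_inj.
  by rewrite -tuple_eta.
rewrite -(pair_bigA _ (fun y (t : j.-tuple T) => if a x y && path a y t then 1 else 0)) /=.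
apply: eq_bigr => y _; rewrite -IHj big_distrr /=; apply: eq_bigr => t _.
by case: (a x y); rewrite ?mul1n.
Qed.

End Walks.

(** * Sparse neighbourhoods from a forbidden odd cycle *)

Lemma inner_nbh_le (T : finType) (a : rel T) (k : nat) (x : T) :
    symmetric a -> irreflexive a -> 0 < k ->
    (forall x s, size s = 2 * k -> uniq (x :: s) -> path a x s -> ~~ a (last x s) x) ->
  inner a (nbh a x) <= 4 * k * #|T|.
Proof.
move=> a_sym a_irr k_gt0 no_cyc.
(* A path on [2k] vertices, hence with [2k - 1] steps, inside the neighbourhood of [x] closes
   through [x] to a cycle on [2k + 1] vertices. *)
apply: (@leq_trans (2 * (2 * k).-1 * #|nbh a x|)).
  apply: inner_le_of_no_path => // y s sz_s uniq_s path_s sN.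
  have aN z : z \in y :: s -> a x z by move/sN; rewrite inE.
  have /negP[] : ~~ a (last y s) x.
    apply: (no_cyc x (y :: s)).
    - by rewrite /= sz_s prednK // muln_gt0.
    - rewrite cons_uniq uniq_s andbT; apply/negP => /aN.
      by rewrite a_irr.
    - by rewrite /= path_s andbT aN ?mem_head.
  by rewrite a_sym aN ?mem_last.
apply: leq_mul; first by lia.
exact: max_card.
Qed.

Lemma set2_eq (T : finType) (a b c d : T) :
  [set a; b] = [set c; d] -> (a = c /\ b = d) \/ (a = d /\ b = c).
Proof.
move=> E.
have /set2P[] : a \in [set c; d] by rewrite -E set21.
  move=> ac; left; split=> //; subst c.
  have /set2P[ba|//] : b \in [set a; d] by rewrite -E set22.
  by have /set2P[->|->] : d \in [set a; b] by rewrite E set22.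
move=> ad; right; split=> //; subst d.
have /set2P[//|ba] : b \in [set c; a] by rewrite -E set22.
by have /set2P[->|->] : c \in [set a; b] by rewrite E set21.
Qed.

(** * Copies of a path and their two parametrisations *)

Section PathCopies.
Variables (n p : nat).
Implicit Types (v w : {ffun 'I_p.+2 -> 'I_n}) (G : {set {set 'I_n}}).

Lemma mem_path_edges v (i j : 'I_p.+2) :
  j = i.+1 :> nat -> [set v i; v j] \in path_edges v.
Proof. by move=> ij; apply/imset2P; exists i j => //; rewrite !inE; apply/eqP. Qed.

Lemma path_edges_nbr v (i : 'I_p.+2) y :
    injective v -> [set v i; y] \in path_edges v ->
  exists2 j : 'I_p.+2, y = v j & j = i.+1 :> nat \/ i = j.+1 :> nat.
Proof.
move=> v_inj /imset2P[a b _]; rewrite !inE => /eqP ba /set2_eq[] [/v_inj ia ->].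
  by exists b => //; left; rewrite ia.
by exists a => //; right; rewrite ia.
Qed.

(** From a fixed start the path is forced: each next vertex is the neighbour of the current one that
    was not just visited. *)
Lemma path_edges_inj_head v w : injective v -> injective w ->
  path_edges v = path_edges w -> v ord0 = w ord0 -> v = w.
Proof.
move=> v_inj w_inj E e0; apply/ffunP.
suff eq_vw : forall m (i : 'I_p.+2), i < m -> v i = w i.
  by move=> i; apply: (eq_vw i.+1).
elim=> // m IHm i; rewrite ltnS => le_im.
have [i0|i_gt0] := posnP i.
  by have -> : i = ord0 by apply: val_inj.
have i'P : i.-1 < p.+2 by apply: leq_ltn_trans (ltn_ord i); exact: leq_pred.
pose i' := Ordinal i'P.
have ii' : i = i'.+1 :> nat by rewrite /= prednK.
have lt_i'm : i' < m by rewrite -ii'.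
have := mem_path_edges w ii'; rewrite -E -(IHm i' lt_i'm).
case/(path_edges_nbr v_inj) => j wj [ji'|i'j].
  by rewrite wj; congr (v _); apply: val_inj; rewrite /= ji' ii'.
(* Otherwise [w i] is the predecessor [v j], which equals [w j] by induction, so [w] would repeat a
   vertex. *)
have wij : i = j by apply: w_inj; rewrite wj IHm //; lia.
by move: i'j; rewrite -wij; lia.
Qed.

(** An end of the path has one neighbour, whereas an inner vertex [w j] has the two distinct
    neighbours before and after it. *)
Lemma path_edges_end v w : injective v -> injective w ->
  path_edges v = path_edges w -> v ord0 = w ord0 \/ v ord0 = w ord_max.
Proof.
move=> v_inj w_inj E.
have v1 j : [set v ord0; w j] \in path_edges v -> w j = v (lift ord0 ord0).
  case/(path_edges_nbr v_inj) => b -> [b1|] //.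
  by congr (v _); apply: val_inj.
have [j v0j] : exists j, v ord0 = w j.
  have : [set v ord0; v (lift ord0 ord0)] \in path_edges w.
    by rewrite -E mem_path_edges.
  by case/imset2P => a b _ _ /set2_eq[] [-> _]; [exists a|exists b].
have [j0|j0] := eqVneq j ord0; first by left; rewrite v0j j0.
have [jM|jM] := eqVneq j ord_max; first by right; rewrite v0j jM.
have j_gt0 : 0 < j by rewrite lt0n; apply: contraNneq j0 => j0; apply/eqP/val_inj.
have j_lt : j.+1 < p.+2.
  have := ltn_ord j; rewrite leq_eqVlt => /orP[/eqP[jp]|//].
  by case/eqP: jM; apply: val_inj.
have jP : j.-1 < p.+2 by lia.
have a1 : w (Ordinal jP) = v (lift ord0 ord0).
  apply: v1; rewrite v0j setUC E; apply: mem_path_edges; rewrite /=; lia.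
have a2 : w (Ordinal j_lt) = v (lift ord0 ord0).
  by apply: v1; rewrite v0j E mem_path_edges.
by have /(congr1 val) /= := w_inj _ _ (etrans a1 (esym a2)); lia.
Qed.

Definition rev_ffun v : {ffun 'I_p.+2 -> 'I_n} := [ffun i => v (rev_ord i)].

Lemma rev_ffunK : involutive rev_ffun.
Proof. by move=> v; apply/ffunP => i; rewrite !ffunE rev_ordK. Qed.

Lemma rev_ffun_inj v : injective v -> injective (rev_ffun v).
Proof. by move=> v_inj i j; rewrite !ffunE => /v_inj/rev_ord_inj. Qed.

Lemma path_edges_rev v : path_edges (rev_ffun v) = path_edges v.
Proof.
suff sub w : path_edges (rev_ffun w) \subset path_edges w.
  by apply/eqP; rewrite eqEsubset sub -{1}(rev_ffunK v) sub.
apply/subsetP => e /imset2P[i j _]; rewrite !inE => /eqP ij ->.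
by rewrite !ffunE setUC mem_path_edges //=; have := ltn_ord j; lia.
Qed.

Definition path_embeddings G : {set {ffun 'I_p.+2 -> 'I_n}} :=
  [set v : {ffun 'I_p.+2 -> 'I_n} | injectiveb v && (path_edges v \subset G)].

(** Reversal pairs up the embeddings of one copy; [X1] keeps the orientation whose first vertex is
    the smaller end, so it has one embedding per copy. *)
Lemma card_path_embeddings G : #|path_embeddings G| = 2 * #|path_copies p.+2 G|.
Proof.
set X := path_embeddings G.
pose X1 := [set v in X | v ord0 < v ord_max].
have inX1 v : (v \in X1) = (v \in X) && (v ord0 < v ord_max) by rewrite in_set.
have XP v : v \in X -> injective v by rewrite inE => /andP[/injectiveP].
have Xrev v : (rev_ffun v \in X) = (v \in X).
  suff sub w : w \in X -> rev_ffun w \in X.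
    by apply/idP/idP => [/sub|/sub]; rewrite ?rev_ffunK.
  move=> wX; rewrite inE path_edges_rev; apply/andP; split.
    by apply/injectiveP/rev_ffun_inj/XP.
  by move: wX; rewrite inE => /andP[].
have rev0 v : rev_ffun v ord0 = v ord_max.
  by rewrite ffunE; congr (v _); apply: val_inj; rewrite /= subSS subn0.
have revM v : rev_ffun v ord_max = v ord0.
  by rewrite -[in RHS](rev_ffunK v) rev0.
have v0M v : v \in X -> v ord0 != v ord_max :> nat.
  by move=> /XP v_inj; apply/eqP => /val_inj/v_inj.
have eX2 : X :\: X1 = rev_ffun @: X1.
  apply/setP => v; rewrite -[v in RHS]rev_ffunK mem_imset; last exact: inv_inj rev_ffunK.
  rewrite in_setD !inX1 Xrev rev0 revM; have [vX|//] := boolP (v \in X).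
  by rewrite !andbT -leqNgt ltn_neqAle eq_sym v0M.
have eX : #|X| = 2 * #|X1|.
  have sX1 : X1 \subset X by apply/subsetP => v; rewrite inX1 => /andP[].
  rewrite -(cardsID X1 X) (setIidPr sX1) eX2 card_imset ?mul2n ?addnn //.
  exact: inv_inj rev_ffunK.
rewrite eX -(@card_in_imset _ _ (@path_edges n p.+2) (mem X1)).
  congr (2 * _); apply: eq_card => E; rewrite [in RHS]inE.
  apply/imsetP/existsP => [[v]|[v /and3P[v_inj /eqP-> sG]]].
    rewrite inX1 inE => /andP[/andP[v_inj sG] _] ->; exists v.
    by rewrite v_inj eqxx.
  have vX : v \in X by rewrite inE v_inj.
  have := v0M v vX; rewrite neq_ltn => /orP[lt|gt].
    by exists v => //; rewrite inX1 vX.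
  exists (rev_ffun v); last by rewrite path_edges_rev.
  by rewrite inX1 Xrev vX rev0 revM.
move=> v w; rewrite !inX1 => /andP[/XP v_inj v_lt] /andP[/XP w_inj w_lt] E.
have [|eM] := path_edges_end v_inj w_inj E; first exact: path_edges_inj_head.
have vw : v = rev_ffun w.
  apply: path_edges_inj_head => //; first exact: rev_ffun_inj.
    by rewrite path_edges_rev.
  by rewrite rev0.
by move: v_lt; rewrite vw rev0 revM ltnNge ltnW.
Qed.

End PathCopies.

(** * Upper bound for a graph without the cycle *)

Section Upper.
Variables (n : nat) (G : {set {set 'I_n}}).
Hypothesis graphG : is_graph G.

Definition adj : rel 'I_n := fun x y => [set x; y] \in G.

Lemma adj_sym : symmetric adj.
Proof. by move=> x y; rewrite /adj setUC. Qed.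

Lemma adj_irr : irreflexive adj.
Proof.
move=> x; apply/negP => xG; have /forallP/(_ [set x; x]) := graphG.
by move: xG; rewrite /adj => -> /=; rewrite setUid cards1.
Qed.

Lemma no_cycle_seq m x s : ~~ has_cycle m.+1 G -> size s = m ->
  uniq (x :: s) -> path adj x s -> ~~ adj (last x s) x.
Proof.
move=> noC sz_s uniq_s path_s; apply: contra noC => closes.
apply/existsP; exists [ffun i : 'I_m.+1 => nth x (x :: s) i]; apply/andP; split.
  apply/injectiveP => i j; rewrite !ffunE => /eqP.
  by rewrite nth_uniq //= ?sz_s ?ltn_ord // => /eqP/val_inj.
apply/subsetP => e /imset2P[i j _]; rewrite !inE => /eqP ji ->; rewrite !ffunE.
(* Below index [m] the edge is a step of the path; at [m] the successor wraps to 0 and the edge is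
   the closing one. *)
have [lt_im|] := ltnP i m.
  rewrite ji modn_small ?ltnS //=.
  by have /pathP/(_ i) := path_s; rewrite sz_s; apply.
have := ltn_ord i; rewrite ltnS => le_im le_mi.
have im : i = m :> nat by apply/eqP; rewrite eqn_leq le_im.
rewrite ji im modnn /=; move: closes; rewrite (last_nth x) sz_s.
by [].
Qed.

(** Embeddings are grouped by first vertex; the remaining [p + 1] vertices then form a walk that
    determines the embedding. *)
Lemma card_path_embeddings_le p :
  #|path_embeddings p G| <= \sum_x walks adj p.+1 x.
Proof.
rewrite -sum1_card (partition_big (fun v : {ffun 'I_p.+2 -> 'I_n} => v ord0) predT) //.
apply: leq_sum => x _; rewrite -card_walk_tuples sum1dep_card.
set X := [set _ | _].
pose tl (v : {ffun 'I_p.+2 -> 'I_n}) := [tuple v (lift ord0 i) | i < p.+1].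
have XP v : v \in X -> v ord0 = x /\ path_edges v \subset G.
  by rewrite !inE => /andP[/andP[_ ->] /eqP->].
have tl_inj : {in X &, injective tl}.
  move=> v w /XP[v0 _] /XP[w0 _] E; apply/ffunP => i.
  have [j ->|->] := unliftP ord0 i; last by rewrite v0 w0.
  by have := congr1 (fun t => tnth t j) E; rewrite !tnth_mktuple.
rewrite -(card_in_imset tl_inj); apply: subset_leq_card.
apply/subsetP => t /imsetP[v /XP[v0 /subsetP sG] ->]; rewrite inE.
have nth_tl i (lt_i : i < p.+1) : nth x (tl v) i = v (lift ord0 (Ordinal lt_i)).
  by rewrite -(tnth_mktuple (fun i => v (lift ord0 i))) (tnth_nth x).
apply/(pathP x) => i; rewrite size_tuple => lt_i.
rewrite nth_tl; case: i lt_i => [|i] lt_i /=.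
  by rewrite -v0; apply/sG/mem_path_edges.
by rewrite (nth_tl i (ltnW lt_i)); apply/sG/mem_path_edges.
Qed.

End Upper.

Lemma ex_path_cycle_le n l k : 0 < k -> 1 < l ->
  2 ^ l * ex_path_cycle n l (2 * k + 1) <= (n + 8 * k) ^ l.
Proof.
case: l => [|[|p]] // k_gt0 _; rewrite /ex_path_cycle addn1.
elim/big_ind: _ => [|x y hx hy|G]; first by rewrite muln0.
  by rewrite /maxn; case: ifP.
move=> /andP[graphG noC].
have inner_le x : inner (adj G) (nbh (adj G) x) <= 4 * k * #|'I_n|.
  apply: inner_nbh_le => //; [exact: adj_sym|exact: adj_irr|].
  by move=> y s; exact: no_cycle_seq.
(* With [c = 4k] the base is [n + 8k]. The walk bound carries [2 ^ p.+1]; the missing factor 2 comes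
   from the two orientations of each copy. *)
have := sum_walks_le (adj_sym G) inner_le p.+1.
rewrite card_ord mulnA; apply: leq_trans.
rewrite expnSr -mulnA leq_mul2l -card_path_embeddings.
by rewrite card_path_embeddings_le orbT.
Qed.

(** * Lower bound from the complete bipartite graph *)

Definition parity_graph n : {set {set 'I_n}} :=
  [set [set x; y] | x in 'I_n, y in 'I_n & odd x != odd y].

Lemma mem_parity_graph n (x y : 'I_n) :
  ([set x; y] \in parity_graph n) = (odd x != odd y).
Proof.
apply/imset2P/idP => [[a b _]|oxy]; last by exists x y; rewrite ?inE.
by rewrite !inE => ab /set2_eq[] [-> ->] //; rewrite eq_sym.
Qed.

Lemma parity_graph_is_graph n : is_graph (parity_graph n).
Proof.
apply/forallP => e; apply/implyP => /imset2P[x y _]; rewrite !inE => oxy ->.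
by rewrite cards2; have -> : x != y by apply: contraNneq oxy => ->.
Qed.

(** Parity alternates along the cycle, so the vertices at indices [2k] and 0 agree in parity
    although they are adjacent. *)
Lemma parity_graph_no_odd_cycle n k : ~~ has_cycle (2 * k + 1) (parity_graph n).
Proof.
rewrite addn1; apply/negP => /existsP[v /andP[_ /subsetP sG]].
have step (i j : 'I_(2 * k).+1) : j = i.+1 %% (2 * k).+1 :> nat ->
    odd (v j) = ~~ odd (v i).
  move=> ij; have : [set v i; v j] \in parity_graph n.
    by apply: sG; apply/imset2P; exists i j => //; rewrite !inE; apply/eqP.
  by rewrite mem_parity_graph; case: (odd (v i)) (odd (v j)) => [] [].
have par i (lt_i : i < (2 * k).+1) : odd (v (Ordinal lt_i)) = odd i (+) odd (v ord0).
  elim: i lt_i => [|i IHi] lt_i.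
    by have -> : Ordinal lt_i = ord0 by apply: val_inj.
  rewrite (step (Ordinal (ltnW lt_i))) ?IHi /= ?modn_small //.
  by case: (odd i); case: (odd _).
have := step (Ordinal (ltnSn (2 * k))) ord0; rewrite par /= modnn => /(_ erefl).
by rewrite oddM /=; case: (odd _).
Qed.

(** Makes [2i + b] a vertex of parity [b]; for odd [n] the vertex [n - 1] is never reached. *)
Lemma double_bit_ltn n (i : 'I_n./2) (b : bool) : i.*2 + b < n.
Proof. by have := ltn_ord i; case: b; lia. Qed.

(** Requiring distinct halves excludes using both [2i] and [2i + 1], a lower-order loss. The two
    starting parities offset the two orientations of a copy. *)
Lemma ex_path_cycle_ge n l k : 1 < l ->
  n./2 ^_ l <= ex_path_cycle n l (2 * k + 1).
Proof.
case: l => [|[|p]] // _.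
apply: (@leq_trans #|path_copies p.+2 (parity_graph n)|); last first.
  apply: (@leq_bigmax_cond _ _ (fun G => #|path_copies p.+2 G|)).
  by rewrite parity_graph_is_graph parity_graph_no_odd_cycle.
rewrite -(leq_pmul2l (isT : 0 < 2)) -card_path_embeddings.
pose A := setX [set: bool] [set f : {ffun 'I_p.+2 -> 'I_n./2} | injectiveb f].
have -> : 2 * n./2 ^_ p.+2 = #|A|.
  by rewrite cardsX cardsT card_bool card_inj_ffuns !card_ord.
(* A path alternating between the two parity classes is a starting parity
   together with the injective sequence of the halves of its vertices. *)
pose F (q : bool * {ffun 'I_p.+2 -> 'I_n./2}) : {ffun 'I_p.+2 -> 'I_n} :=
  [ffun i => Ordinal (double_bit_ltn (q.2 i) (odd i (+) q.1))].
have halfF q i : (F q i)./2 = q.2 i.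
  by rewrite ffunE /= addnC half_bit_double.
have oddF q i : odd (F q i) = odd i (+) q.1.
  by rewrite ffunE /= oddD odd_double /=; case: (_ (+) _).
have F_inj : injective F.
  move=> [b f] [c g] E; congr (_, _).
    by have := oddF (b, f) ord0; rewrite E oddF /=.
  by apply/ffunP => i; apply: val_inj; have := halfF (b, f) i; rewrite E halfF.
rewrite -(card_imset _ F_inj); apply: subset_leq_card.
apply/subsetP => v /imsetP[q]; rewrite !inE => /injectiveP f_inj ->.
apply/andP; split.
  by apply/injectiveP => i j E; apply/f_inj/val_inj; have := halfF q i; rewrite E halfF.
apply/subsetP => e /imset2P[i j _]; rewrite !inE => /eqP ij ->.
by rewrite mem_parity_graph !oddF ij /=; case: (odd i); case: q.1.
Qed.

Lemma expn_sub_le_ffact m l : (m - l) ^ l <= m ^_ l.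
Proof.
elim: l m => // l IHl [|m]; first by rewrite sub0n exp0n.
rewrite subSS ffactSS expnS leq_mul // leq_subLR; lia.
Qed.

(* Passage to the limit *)
From mathcomp Require Import all_classical all_reals all_analysis.
Import Order.TTheory GRing.Theory Num.Theory.
Import numFieldNormedType.Exports.
Local Open Scope classical_set_scope.
Local Open Scope ring_scope.

Lemma cvg_expr_1Ddivn (R : realType) (c : R) (l : nat) :
  (1 + c / n%:R) ^+ l @[n --> \oo] --> (1 : R).
Proof.
have inv0 : (n%:R : R)^-1 @[n --> \oo] --> (0 : R).
  apply/gtr0_cvgV0; last exact: cvgr_idn.
  by exists 1%N => // n /= n_gt0; rewrite ltr0n.
have base : 1 + c / n%:R @[n --> \oo] --> (1 : R).
  rewrite -[X in _ --> X]addr0 -[X in _ + X](mulr0 c).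
  by apply: cvgD; [exact: cvg_cst | apply: cvgM; [exact: cvg_cst|]].
rewrite -[X in _ --> X](expr1n R l).
elim: l => [|l IHl]; first by under eq_fun do rewrite expr0; exact: cvg_cst.
by under eq_fun do rewrite exprS; rewrite exprS; exact: cvgM.
Qed.

Theorem theorem19 (R : realType) (k l : nat) (hk : (1 <= k)%N) (hl : (2 <= l)%N) :
  (fun n : nat => (ex_path_cycle n l (2 * k + 1))%:R / ((n%:R / 2) ^+ l) : R)
    @ \oo --> (1 : R).
Proof.
(* After division by [(n/2)^l] the bounds are powers of [1 + c/n]. Below, [c = -(2l + 1)], because
   [2 * (n./2 - l) >= n - 1 - 2l]. *)
apply: (squeeze_cvgr _ (cvg_expr_1Ddivn (- (2 * l + 1)%:R) l)
  (cvg_expr_1Ddivn ((8 * k)%:R) l)).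
(* From here on [n] is nonzero and the natural subtraction [n - (2l + 1)] is exact. *)
exists (2 * l + 1)%N => // n /= le_ln.
have n_gt0 : 0 < n%:R :> R by rewrite ltr0n (leq_trans _ le_ln) // addn1.
have n_neq0 := lt0r_neq0 n_gt0.
have E c : 1 + c / n%:R = (n%:R + c) / n%:R :> R by rewrite mulrDl divff.
have -> x : x / ((n%:R / 2) ^+ l) = (2 ^+ l * x) / n%:R ^+ l :> R.
  by rewrite expr_div_n invf_div mulrA [x * _]mulrC.
rewrite !E !expr_div_n -natrB // -natrD -!natrX -natrM.
have nl_gt0 : 0 < (n ^ l)%:R^-1 :> R by rewrite invr_gt0 natrX exprn_gt0.
rewrite !(ler_pM2r nl_gt0) !ler_nat.
apply/andP; split; last exact: ex_path_cycle_le.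
apply: (@leq_trans (2 ^ l * (n./2 - l) ^ l)%N).
  by rewrite -expnMn leq_exp2r; lia.
rewrite leq_mul2l (leq_trans (expn_sub_le_ffact _ _)) ?orbT //.
exact: ex_path_cycle_ge.
Qed.
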